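(* Let $\omega>0$ and $K\in L^1(\mathbb{R})$. Assume that there exists a bounded solution $u$ of $$\partial_t u(x,t)=c\,\partial_x^2u(x,t)+\int_{\mathbb{R}}\big(u(y,t)-\Theta\big)_+\,K(x-y)\,dy,\qquad x\in\mathbb{R},\ t\in\mathbb{R},$$ of the form $$u(x,t)=v(x+\omega t)+\Theta$$ for some $v:\mathbb{R}\to\mathbb{R}$. Then $u$ is necessarily constant.
   Context: Here $c\in(0,+\infty)$, $\Theta\in\mathbb{R}$, $r_+:=\max\{r,0\}$, and $K:\mathbb{R}\to[0,+\infty)$ is nonnegative. Solutions are classical: $u$ is continuously differentiable in $t$ and twice continuously differentiable in $x$, so that $v\in C^2(\mathbb{R})$, and the equation holds pointwise. *)

(* Defs.v *)
From mathcomp Require Import all_boot all_order all_algebra.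
From mathcomp Require Import all_classical all_reals all_analysis.
Import Order.TTheory GRing.Theory Num.Theory numFieldNormedType.Exports.

Set Implicit Arguments.
Unset Strict Implicit.
Unset Printing Implicit Defensive.

Local Open Scope ring_scope.
Local Open Scope classical_set_scope.

Definition is_C1 (R : realType) (f : R -> R) : Prop :=
  (forall x, derivable f x 1) /\ continuous f^`().

Definition is_C2 (R : realType) (f : R -> R) : Prop :=
  (forall x, derivable f x 1) /\ is_C1 f^`().

(* [lebesgue_measure] only integrates Borel functions, so membership in L^1(R)
   and the integral below are taken with respect to its completion, for which
   every Lebesgue measurable function is allowed. *)
Definition Lebesgue_integrable (R : realType) (f : R -> R) : Prop :=
  (@completed_lebesgue_measure R).-integrable setT (fun z : R => (f z)%:E).

(* The equation is stated in \bar R so that it also asserts the finiteness of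
   the integral. *)
Definition classical_solution (R : realType) (c Theta : R) (K : R -> R)
    (u : R -> R -> R) : Prop :=
  [/\ forall x, is_C1 (fun t => u x t),
      forall t, is_C2 (fun x => u x t) &
      forall x t : R,
        ((derive1 (fun s => u x s) t)%:E =
         (c * derive1n 2 (fun y => u y t) x)%:E +
         \int[@completed_lebesgue_measure R]_y
           (Num.max (u y t - Theta) 0 * K (x - y))%:E :> \bar R)%E].

(* Main.v *)
Require Import Defs.
From mathcomp Require Import all_boot all_order all_algebra.
From mathcomp Require Import all_classical all_reals all_analysis.
From mathcomp Require Import lra.
Import Order.TTheory GRing.Theory Num.Theory numFieldNormedType.Exports.

Local Open Scope ring_scope.
Local Open Scope classical_set_scope.

(** The profile [v] satisfies [omega v' - c v'' = F], where the source
    [F s = \int_y (v (y + s))_+ K (- y)] is nonnegative.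

    Because [F >= 0], the function [exp (- omega s / c) v' s] is nonincreasing,
    so a negative value of [v'] would persist to the right and drive [v] to
    minus infinity; as [v] is bounded, [v] is nondecreasing
    ([derive_ge0_of_supersolution]).  Then [F] is nondecreasing as well, since
    [K >= 0].  If [F] were positive at some point, it would stay above a
    positive constant to the right of it, so [c v' - omega v], whose derivative
    is [- F], would tend to minus infinity; but [v' >= 0] and [v] is bounded
    ([derive_le_neg_unbounded]).  Hence [F = 0], the equation becomes linear,
    and the monotonicity argument applies to [- v] too: [v' = 0].

    The formula for [F] comes from setting [x = 0] in the equation and letting
    only [t] vary: the translation then acts on [v] and not on [K], so that
    [F] visibly inherits the monotonicity of [v]. *)

Lemma derive_le_neg_unbounded {R : realType} {w w1 : R -> R} {x0 e : R} :
  0 < e -> (forall x : R, is_derive x 1 w (w1 x)) ->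
  (forall x, x0 <= x -> w1 x <= - e) ->
  forall M, exists2 x, x0 <= x & w x < M.
Proof.
move=> e0 dw w1e M.
(* At distance [d] from [x0] the mean value theorem bounds [w] by
   [w x0 - e * d], which is at most [M - e]. *)
pose d := 1 + `|w x0 - M| / e.
have d0 : 0 < d by rewrite ltr_pwDl// divr_ge0// ltW.
have ed : e * d = e + `|w x0 - M| by rewrite mulrDr mulr1 mulrC divfK ?gt_eqF.
exists (x0 + d); first by rewrite lerDl ltW.
have x0d : x0 < x0 + d by rewrite ltrDl.
have [|z /itvP zI] := @MVT R w w1 _ _ x0d (fun x _ => dw x).
  by apply: derivable_within_continuous => x _; have [] := dw x.
rewrite [x0 + d]addrC addrK => wE.
have : w1 z * d <= - e * d by rewrite ler_pM2r// w1e// zI.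
rewrite -wE mulNr ed => H.
have := ler_norm (w x0 - M).
lra.
Qed.

(** The product [exp (- a x) w'] is nonincreasing, so once [w'] is negative it
    stays below that negative value, and [w] cannot be bounded below. *)
Lemma derive_ge0_of_supersolution {R : realType} {a m : R}
    {w w1 w2 : R -> R} :
  0 <= a ->
  (forall x : R, is_derive x 1 w (w1 x)) -> (forall x : R, is_derive x 1 w1 (w2 x)) ->
  (forall x, w2 x <= a * w1 x) -> (forall x, m <= w x) ->
  forall x, 0 <= w1 x.
Proof.
move=> a0 dw dw1 w2le wm x0; rewrite leNgt; apply/negP => w1x0.
suff w1le x : x0 <= x -> w1 x <= - (- w1 x0).
  have [|x _] := @derive_le_neg_unbounded _ _ _ _ (- w1 x0) _ dw w1le m.
    by rewrite oppr_gt0.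
  by rewrite ltNge wm.
rewrite opprK => x0x.
pose E y := expR (- a * (y - x0)).
have dE (y : R) : is_derive y 1 E (- a * E y).
  have -> : - a * E y = E y * (- a) by rewrite mulrC.
  apply: (@is_derive1_comp R expR (fun y => - a * (y - x0))).
  apply: is_derive_eq.
  by rewrite subr0 /GRing.scale /= mulr1.
have dg (y : R) : is_derive y 1 (E * w1) (E y * (w2 y - a * w1 y)).
  apply: is_derive_eq.
  rewrite /GRing.scale /=.
  lra.
have [|z _] := @MVT_segment R (E * w1) _ _ _ x0x (fun y _ => dg y).
  apply: derivable_within_continuous => y _.
  by have [] := dg y.
move=> gE.
have : (E * w1) x - (E * w1) x0 <= 0.
  rewrite gE mulr_le0_ge0 ?subr_ge0//.
  by rewrite mulr_ge0_le0 ?expR_ge0// subr_le0.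
rewrite subr_le0.
have -> : (E * w1) x0 = w1 x0.
  by rewrite -[LHS]/(E x0 * w1 x0) /E subrr mulr0 expR0 mul1r.
rewrite -[(E * w1) x]/(E x * w1 x).
have E1 : E x <= 1 by rewrite expR_le1// mulNr oppr_le0 mulr_ge0// subr_ge0.
have E0 : 0 < E x by exact: expR_gt0.
move=> H.
have w1x : w1 x < 0.
  by rewrite -(pmulr_rlt0 _ E0); exact: le_lt_trans H w1x0.
apply: le_trans H.
by rewrite ler_niMl// ltW.
Qed.

(** The integral of a nonnegative function is a supremum over the simple
    functions below it, hence monotone.  This avoids proving that reflections
    preserve Lebesgue measurable sets, which the measurability of
    [y |-> K (- y)] would require. *)
Lemma ge0_le_integral_nonmeasurable d (T : measurableType d) (R : realType)
    (mu : {measure set T -> \bar R}) (f g : T -> \bar R) :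
  (forall x, (0 <= f x)%E) -> (forall x, (f x <= g x)%E) ->
  (\int[mu]_x f x <= \int[mu]_x g x)%E.
Proof.
move=> f0 fg.
have g0 x : (0 <= g x)%E := le_trans (f0 x) (fg x).
rewrite !ge0_integralTE//.
apply: ereal_sup_le => _ [h /= hf <-]; exists h => //= x.
exact: le_trans (hf x) (fg x).
Qed.

Definition wave_source {R : realType} (K v : R -> R) (s : R) : \bar R :=
  (\int[@completed_lebesgue_measure R]_y
     (Num.max (v (y + s)) 0 * K (0 - y))%:E)%E.

Lemma wave_source_ge0 (R : realType) (K v : R -> R) (s : R) :
  (forall z, 0 <= K z) -> (0 <= wave_source K v s)%E.
Proof.
move=> K0; apply: integral_ge0 => y _.
by rewrite lee_fin mulr_ge0// le_max lexx orbT.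
Qed.

Lemma wave_source_homo (R : realType) (K v : R -> R) :
  (forall z, 0 <= K z) -> {homo v : x y / x <= y} ->
  {homo wave_source K v : s t / s <= t >-> (s <= t)%E}.
Proof.
move=> K0 vhomo s t st; apply: ge0_le_integral_nonmeasurable => y.
  by rewrite lee_fin mulr_ge0// le_max lexx orbT.
rewrite lee_fin ler_wpM2r// ge_max !le_max lexx orbT andbT.
by rewrite vhomo// lerD2l.
Qed.

(** On the line [x = 0] the wave shows the profile at [omega * t], which takes
    every real value as [omega != 0]. *)
Lemma wave_profile_equation {R : realType} {c Theta omega : R} {K : R -> R}
    {u : R -> R -> R} {v : R -> R} :
  omega != 0 ->
  classical_solution c Theta K u ->
  (forall x t, u x t = v (x + omega * t) + Theta) ->
  exists v1 v2 : R -> R,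
    [/\ forall s : R, is_derive s 1 v (v1 s),
        forall s : R, is_derive s 1 v1 (v2 s) &
        forall s, (omega * v1 s - c * v2 s)%:E = wave_source K v s].
Proof.
move=> omega0 [_ uC2 ueq] uE.
have vE : v = (fun s => u s 0 - Theta).
  by apply/funext => s; rewrite uE mulr0 addr0 addrK.
have [ud [u1d _]] := uC2 0.
have dv (s : R) : is_derive s 1 v (v^`() s).
  by rewrite derive1E; apply: derivableP; rewrite vE; exact: derivableB.
have v1E : v^`() = (fun x => u x 0)^`().
  apply/funext => s; rewrite !derive1E vE deriveB//.
  by rewrite derive_cst subr0.
have dv1 (s : R) : is_derive s 1 v^`() (v^`()^`() s).
  by rewrite [v^`()^`() s]derive1E; apply: derivableP; rewrite v1E; exact: u1d.
exists v^`(), v^`()^`(); split => // s.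
pose t := omega^-1 * s.
have omegat : omega * t = s by rewrite mulrA divff// mul1r.
have ut : (fun r => u 0 r)^`() t = omega * derive1 v s.
  have -> : (fun r => u 0 r) = (v \o (fun r => omega * r)) + cst Theta.
    by apply/funext => r; rewrite uE add0r.
  rewrite derive1E; apply: derive_val.
  have dm : is_derive t 1 (fun r => omega * r) omega.
    by apply: is_derive_eq; rewrite /GRing.scale /= mulr1.
  have dvt : is_derive (omega * t) 1 v (v^`() s) by rewrite omegat.
  by apply: is_derive_eq; rewrite addr0 mulrC.
have uxx : derive1n 2 (fun y => u y t) 0 = derive1 (derive1 v) s.
  rewrite derive1nS derive1nS /=.
  have dsh (f : R -> R) : (forall z : R, derivable f z 1) ->
      (f \o shift s)^`() = f^`() \o shift s.
    move=> df; apply/funext => y; rewrite [LHS]derive1E; apply: derive_val.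
    have dsy : is_derive (y : R) (1 : R) (shift s : R -> R) 1.
      exact: is_derive_shift.
    have dfy : is_derive (y + s) 1 f (f^`() (y + s)).
      by rewrite derive1E; apply: derivableP.
    by apply: is_derive_eq; rewrite mulr1.
  have -> : (fun y => u y t) = (v \o shift s) + cst Theta.
    by apply/funext => y; rewrite uE omegat.
  have -> : ((v \o shift s) + cst Theta)^`() = (v \o shift s)^`().
    apply/funext => y; rewrite !derive1E.
    have dsy : is_derive (y : R) (1 : R) (shift s : R -> R) 1.
      exact: is_derive_shift.
    by rewrite deriveD// derive_cst addr0.
  rewrite dsh; last by move=> z; have [] := dv z.
  rewrite dsh; last by move=> z; have [] := dv1 z.
  by rewrite /= add0r.
have := ueq 0 t; rewrite ut uxx => ueqs.
have -> : wave_source K v s = (\int[@completed_lebesgue_measure R]_y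
           (Num.max (u y t - Theta) 0 * K (0 - y))%:E)%E.
  by apply: eq_integral => y _; rewrite uE omegat addrK.
by rewrite EFinB ueqs addeAC subee// add0e.
Qed.


Theorem theorem2p9 (R : realType) (c Theta omega : R) (K : R -> R)
    (u : R -> R -> R) (v : R -> R)
    (c_gt0 : 0 < c)
    (omega_gt0 : 0 < omega)
    (K_ge0 : forall z, 0 <= K z)
    (K_L1 : Lebesgue_integrable K)
    (u_sol : classical_solution c Theta K u)
    (u_bounded : exists M : R, forall x t, `|u x t| <= M)
    (u_wave : forall x t, u x t = v (x + omega * t) + Theta) :
  exists k : R, forall x t, u x t = k.
Proof.
have [v1 [v2 [dv dv1 veq]]] :=
  wave_profile_equation (lt0r_neq0 omega_gt0) u_sol u_wave.
have [M uM] := u_bounded.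
have vM s : `|v s + Theta| <= M by have := uM s 0; rewrite u_wave mulr0 addr0.
have vge s : - M - Theta <= v s by rewrite lerBlDr; case/ler_normlP: (vM s); lra.
have vle s : v s <= M - Theta by rewrite lerBrDr; case/ler_normlP: (vM s).
have a0 : 0 <= omega / c by rewrite divr_ge0// ltW.
have source0 s : 0 <= omega * v1 s - c * v2 s.
  by rewrite -lee_fin veq wave_source_ge0.
have v1ge0 s : 0 <= v1 s.
  apply: (derive_ge0_of_supersolution a0 dv dv1 _ vge) => {}s.
  by rewrite mulrAC ler_pdivlMr// mulrC -subr_ge0.
have vhomo : {homo v : x y / x <= y}.
  move=> x y xy.
  have [|z _ vE] := @MVT_segment R v v1 _ _ xy (fun z _ => dv z).
    by apply: derivable_within_continuous => z _; have [] := dv z.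
  by rewrite -subr_ge0 vE mulr_ge0// subr_ge0.
(* A positive value of the source persists to the right, where the derivative
   of [c v' - omega v] is then bounded away from 0. *)
have veq0 s : omega * v1 s - c * v2 s = 0.
  apply/eqP; rewrite eq_le source0 andbT leNgt; apply/negP => s_gt0.
  have dg (x : R) : is_derive x 1 (c *: v1 - omega *: v)
                            (- (omega * v1 x - c * v2 x)).
    by apply: is_derive_eq; rewrite /GRing.scale /= opprB.
  have [x sx|x _] := @derive_le_neg_unbounded _ _ _ s _ s_gt0 dg _
    (- (omega * (M - Theta))).
    by rewrite lerN2 -lee_fin !veq wave_source_homo.
  apply/negP; rewrite -leNgt /= -[leLHS]add0r lerD//.
    by rewrite mulr_ge0// ltW.
  by rewrite lerN2 ler_pM2l.
(* With zero source, [- v] satisfies the same differential inequality as [v]. *)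
have v1le0 s : 0 <= - v1 s.
  apply: (@derive_ge0_of_supersolution R (omega / c) (- (M - Theta))
    (- v) (- v1) (- v2)) => // x.
    rewrite -[(- v2) x]/(- v2 x) -[(- v1) x]/(- v1 x) mulrN lerN2.
    by rewrite mulrAC ler_pdivrMr// [v2 x * c]mulrC -subr_le0 veq0.
  by rewrite -[(- v) x]/(- v x) lerN2.
have v1E s : v1 s = 0 by apply/eqP; rewrite eq_le v1ge0 -oppr_ge0 v1le0.
exists (v 0 + Theta) => x t; rewrite u_wave; congr (_ + _).
by apply: is_derive_0_is_cst => s; rewrite -(v1E s).
Qed.
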